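(* Let $\vec p=(p_1,\dots,p_n)$ with $1<p_i<\infty$ for all $i$, let $1\le\theta\le\infty$ and $0<\lambda<\sum_{i=1}^n\frac1{p_i}$. Then there is a constant $C\ge1$ such that for all measurable functions $f:\mathbb R^n\to\mathbb C$, $$C^{-1}\|f\|_{\dot K^{-\lambda,\theta}_{\vec p}}\le\|f\|_{LM^\lambda_{\vec p,\theta}}\le C\|f\|_{\dot K^{-\lambda,\theta}_{\vec p}}.$$
   Context: Mixed Lebesgue norm: for $\vec p=(p_1,\dots,p_n)$ and $f$ measurable on $\mathbb R^n$, $$\|f\|_{L_{\vec p}}=\left(\int_{\mathbb R}\cdots\left(\int_{\mathbb R}\left(\int_{\mathbb R}|f(x_1,\dots,x_n)|^{p_1}dx_1\right)^{p_2/p_1}dx_2\right)^{p_3/p_2}\cdots dx_n\right)^{1/p_n},$$ and $\|f\|_{L_{\vec p}(E)}=\|f\chi_E\|_{L_{\vec p}}$. Local mixed Morrey norm: $$\|f\|_{LM^\lambda_{\vec p,\theta}}=\left(\int_0^\infty\left(r^{-\lambda}\|f\|_{L_{\vec p}(Q(0,r))}\right)^\theta\frac{dr}{r}\right)^{1/\theta},$$ with $\sup_{r>0}r^{-\lambda}\|f\|_{L_{\vec p}(Q(0,r))}$ when $\theta=\infty$; here $Q(0,r)=B(0,r)=\{x\in\mathbb R^n:|x|<r\}$. Homogeneous mixed Herz norm: let $B_j=\{x\in\mathbb R^n:|x|\le2^j\}$ and $\chi_j=\chi_{B_j\setminus B_{j-1}}$ for $j\in\mathbb Z$. For $\alpha\in\mathbb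 R$ and $0<\theta\le\infty$, $$\|f\|_{\dot K^{\alpha,\theta}_{\vec p}}=\left(\sum_{j=-\infty}^\infty2^{j\alpha\theta}\|f\chi_j\|_{L_{\vec p}}^\theta\right)^{1/\theta},$$ with $\sup_{j\in\mathbb Z}2^{j\alpha}\|f\chi_j\|_{L_{\vec p}}$ when $\theta=\infty$. Norms may take the value $+\infty$. *)

(* Defs.v *)
From HB Require Import structures.
From mathcomp Require Import all_boot all_order all_algebra.
From mathcomp Require Import all_classical all_reals all_analysis.
From mathcomp Require Import measurable_realfun.
From mathcomp Require Export complex.

Set Implicit Arguments.
Unset Strict Implicit.
Unset Printing Implicit Defensive.

Import Order.TTheory GRing.Theory Num.Theory.
Import numFieldNormedType.Exports.

Local Open Scope classical_set_scope.
Local Open Scope ring_scope.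
Local Open Scope complex_scope.

(* Tuples carry the product sigma-algebra, so [measurable] on [Rn R n] means
   Borel. *)
Notation Rn R n := (n.-tuple (measurableTypeR R)).

(* Lebesgue measure on the Borel sets of R^n, as the n-fold product of the
   one-dimensional measure. *)
Fixpoint lebesgue_Rn (R : realType) (n : nat) : set (Rn R n) -> \bar R :=
  match n with
  | 0%N => \d_([tuple] : Rn R 0)
  | m.+1 => pushforward (@lebesgue_measure R \x @lebesgue_Rn R m)%E
              (fun z : measurableTypeR R * Rn R m => [tuple of z.1 :: z.2])
  end.

(* R^n equipped with the Lebesgue (completed Borel) sigma-algebra. *)
Notation cRn R n :=
  (g_sigma_algebraType (completed_algebra_gen (@lebesgue_Rn R n))).

Definition lebesgue_measurable (R : realType) (n : nat) (f : Rn R n -> R[i]) :=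
  measurable_fun [set: cRn R n]
    ((fun x => complex.Re (f x)) : cRn R n -> measurableTypeR R) /\
  measurable_fun [set: cRn R n]
    ((fun x => complex.Im (f x)) : cRn R n -> measurableTypeR R).

(* The L^{p_1} norm in x_1, then the L^{p_2} norm in x_2 of the result, and so
   on; the exponents p_{k+1} / p_k of the usual display come from
   (a ^ (1 / p_k)) ^ p_{k+1}.  A section of a Lebesgue measurable function need
   not be Borel: the library integral of a nonnegative function is a supremum
   over Borel simple functions below it, which for Lebesgue measurable functions
   is the Lebesgue integral. *)
Fixpoint iterated_Lnorm (R : realType) (n : nat) :
    n.-tuple R -> (Rn R n -> \bar R) -> \bar R :=
  match n with
  | 0%N => fun _ g => g [tuple]
  | m.+1 => fun p g => @iterated_Lnorm R m [tuple of behead p]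
      (fun y => Lnorm (@lebesgue_measure R) (thead p)%:E
                  (fun x => g [tuple of x :: y]))
  end.

Definition mixed_norm (R : realType) (n : nat) (p : n.-tuple R)
    (f : Rn R n -> R[i]) : \bar R :=
  iterated_Lnorm p (fun x => (Normc.normc (f x))%:E).

Definition mixed_norm_on (R : realType) (n : nat) (p : n.-tuple R)
    (E : set (Rn R n)) (f : Rn R n -> R[i]) : \bar R :=
  mixed_norm p (fun x => f x * \1_E x).

(* Euclidean norm; the library norms on products and matrices are sup norms. *)
Definition enorm (R : realType) (n : nat) (x : Rn R n) : R :=
  Num.sqrt (\sum_(i < n) (tnth x i : R) ^+ 2).

Definition oball (R : realType) (n : nat) (r : R) : set (Rn R n) :=
  [set x | enorm x < r].

Definition dyadic_ball (R : realType) (n : nat) (j : int) : set (Rn R n) :=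
  [set x | enorm x <= 2 ^ j].

Definition dyadic_annulus (R : realType) (n : nat) (j : int) : set (Rn R n) :=
  @dyadic_ball R n j `\` @dyadic_ball R n (j - 1).

(* The value at [theta = -oo] is junk; only positive [theta] is meaningful. *)
Definition local_morrey_norm (R : realType) (n : nat) (p : n.-tuple R)
    (lambda : R) (theta : \bar R) (f : Rn R n -> R[i]) : \bar R :=
  (match theta with
   | t%:E =>
     (\int[@lebesgue_measure R]_(r in `]0%R, +oo[)
        (((r `^ (- lambda))%R%:E * mixed_norm_on p (@oball R n r) f) `^ t
         * r^-1%:E)) `^ t^-1
   | +oo =>
     ereal_sup [set (r `^ (- lambda))%R%:E * mixed_norm_on p (@oball R n r) f
               | r in [set r : R | (0 < r)%R]]
   | -oo => 0
   end)%E.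

Definition herz_norm (R : realType) (n : nat) (p : n.-tuple R)
    (alpha : R) (theta : \bar R) (f : Rn R n -> R[i]) : \bar R :=
  (match theta with
   | t%:E =>
     (\esum_(j in [set: int])
        ((2 `^ (j%:~R * alpha * t))%R%:E
         * (mixed_norm_on p (@dyadic_annulus R n j) f) `^ t)) `^ t^-1
   | +oo =>
     ereal_sup [set (2 `^ (j%:~R * alpha))%R%:E
                    * mixed_norm_on p (@dyadic_annulus R n j) f
               | j in [set: int]]
   | -oo => 0
   end)%E.

(* Main.v *)
From HB Require Import structures.
Require Import Defs.
From mathcomp Require Import all_boot all_order all_algebra.
From mathcomp Require Import all_classical all_reals all_analysis.
From mathcomp Require Import measurable_realfun ring lra.

Set Implicit Arguments.
Unset Strict Implicit.
Unset Printing Implicit Defensive.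

Import Order.TTheory GRing.Theory Num.Theory.
Import numFieldNormedType.Exports.

Local Open Scope classical_set_scope.
Local Open Scope ring_scope.

(** Cut (0, oo) into the octaves I_j = ]2^j, 2^(j+1)].  Write a_j for the mixed
    norm of f on the j-th dyadic annulus, b_j = 2^(-j lambda) a_j for the
    weighted coefficients entering the Herz norm, and
    G(r) = r^(-lambda) |f|_(L_p(Q(0,r))) for the function whose L^theta(dr/r)
    norm is the Morrey norm.  For r in I_j the ball Q(0,r) contains the j-th
    annulus, and away from the origin it is covered by the annuli of index at
    most j+1.  Hence, up to the factor 2^lambda coming from the variation of
    r^(-lambda) over an octave,
      b_j <= 2^lambda G(r),
      G(r) <= sum_(i >= 0) 2^lambda 2^(-lambda i) b_(j+1-i).
    The first bound is monotonicity of the mixed norm; the second one is the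
    countable triangle inequality ([local_norms]).  An octave has dr/r-measure
    between 1/2 and 1, so that the Morrey norm is comparable to the l^theta
    norm over the integers of any quantity comparable to G on each octave.
    The first bound therefore gives Herz <= C Morrey.  In the second one the
    right-hand side is a convolution with a geometric sequence, which is
    summable because lambda > 0; Minkowski's inequality in l^theta
    ([ell_geometric_average]) gives Morrey <= C Herz, with
    C = 2^lambda / (1 - 2^(-lambda)).

    Two points need care.  The sections of a Lebesgue measurable f need not be
    measurable, while the triangle inequality and Tonelli's theorem are used on
    Borel functions.  But the iterated norm does not see a Borel null set
    ([le_iterated_Lnorm_off_null]): by Fubini almost all of its sections are
    null, and the integral, being a supremum over simple functions below the
    integrand, ignores null sets even for non-measurable integrands.  Since
    |f| is Borel off a Borel null set ([completed_fun_borel]), it can be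
    replaced by a Borel function, which moreover may be taken to vanish at the
    origin ([borel_modulus]).  Secondly, the countable triangle inequality for
    extended-real functions ([Lnorm_nneseries]) follows from the real-valued
    finite one by discarding the null set of infinite values and by monotone
    convergence; iterating it over the coordinates, with Tonelli's theorem
    providing measurability of the intermediate functions, yields
    [iterated_Lnorm_nneseries]. *)

(** * Integrals and mixed norms off null sets *)

Section LowerIntegral.
Context d (T : measurableType d) (R : realType).
Variable mu : {measure set T -> \bar R}.
Local Open Scope ereal_scope.
Import HBNNSimple.

(** A simple function below f, multiplied by the indicator of the complement of
    N, keeps its integral and is below g.  The argument applies to sections of
    Lebesgue measurable functions, which can fail to be measurable. *)
Lemma le_integral_off_null (f g : T -> \bar R) (N : set T) :
    measurable N -> mu N = 0 ->
    (forall x, 0 <= f x) -> (forall x, 0 <= g x) ->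
    (forall x, ~ N x -> f x <= g x) ->
  \int[mu]_x f x <= \int[mu]_x g x.
Proof.
move=> mN N0 f0 g0 fg.
rewrite !ge0_integralTE//; apply: ge_ereal_sup => _ [h /= hf <-].
have mNC : measurable (~` N) by exact: measurableC.
pose h' : {nnsfun T >-> R} := mul_nnsfun h (indic_nnsfun R mNC).
have -> : sintegral mu h = sintegral mu h'.
  rewrite -!integralT_nnsfun; apply: ge0_ae_eq_integral => //=.
  - exact/measurable_EFinP.
  - by apply/measurable_EFinP; exact: (@measurable_funPT _ _ _ _ h').
  - by move=> x _; rewrite lee_fin.
  - by move=> x _; rewrite lee_fin; exact: (@fun_ge0 _ _ h').
  exists N; split => // x /=; apply: contra_notP => Nx _.
  by rewrite mindicE mem_set ?mulr1.
apply: ereal_sup_ubound; exists h' => // x /=.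
rewrite mindicE; case: (boolP (x \in ~` N)) => xN.
  by rewrite mulr1 (le_trans (hf x))// fg//; move/set_mem: xN.
by rewrite mulr0.
Qed.

Lemma le_poweR (r : R) (x y : \bar R) : (0 <= r)%R -> 0 <= x -> x <= y ->
  x `^ r <= y `^ r.
Proof.
move=> r0 x0 xy; apply: gt0_ler_poweR => //; rewrite in_itv/= leey andbT//.
exact: le_trans xy.
Qed.

Lemma le_Lnorm_off_null (r : R) (f g : T -> \bar R) (N : set T) : (0 < r)%R ->
    measurable N -> mu N = 0 ->
    (forall x, 0 <= f x) -> (forall x, 0 <= g x) ->
    (forall x, ~ N x -> f x <= g x) ->
  Lnorm mu r%:E f <= Lnorm mu r%:E g.
Proof.
move=> r0 mN N0 f0 g0 fg; rewrite unlock; apply: le_poweR.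
- by rewrite invr_ge0 ltW.
- by apply: integral_ge0 => x _; exact: poweR_ge0.
apply: (@le_integral_off_null _ _ N) => // [x|x|x Nx]; rewrite ?poweR_ge0//.
by rewrite !gee0_abs//; apply: le_poweR; [exact: ltW|exact: f0|exact: fg].
Qed.

End LowerIntegral.

Section LebesgueRn.
Variable R : realType.
Local Open Scope ereal_scope.

Definition cons_pair (m : nat) (z : measurableTypeR R * Rn R m) : Rn R m.+1 :=
  [tuple of z.1 :: z.2].

Lemma measurable_cons_pair m : measurable_fun [set: _] (@cons_pair m).
Proof. exact: measurable_cons. Qed.

Definition uncons_pair (m : nat) (x : Rn R m.+1) :
    measurableTypeR R * Rn R m :=
  (thead x, [tuple of behead x]).

Lemma cons_pairK m : cancel (@cons_pair m) (@uncons_pair m).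
Proof. by move=> [a b]; congr pair; exact: val_inj. Qed.

Lemma measurable_uncons_pair m : measurable_fun [set: _] (@uncons_pair m).
Proof.
apply: measurable_fun_pair; last exact: measurable_behead.
exact: (@measurable_tnth _ (measurableTypeR R) m.+1 ord0).
Qed.

(** Bundles a sigma-finite measure into the structure required by the Fubini
    theorems. *)
Lemma sigma_finite_structure d (T : measurableType d)
    (mu : {measure set T -> \bar R}) : sigma_finite setT mu ->
  exists nu : {sigma_finite_measure set T -> \bar R},
    nu = mu :> (set T -> \bar R).
Proof.
case: mu => mu cmu mus.
pose M := Measure_isSigmaFinite.Build d T R (Measure.Pack cmu) mus.
pose nu : {sigma_finite_measure set T -> \bar R} :=
  HB.pack mu (Measure.Pack cmu) M.
by exists nu.
Qed.

(** The recursion defining the n-dimensional measure produces a bare set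
    function; this exhibits it as a sigma-finite measure, so that the theory
    of product measures applies to it. *)
Lemma lebesgue_Rn_sigma_finite n :
  exists mu : {sigma_finite_measure set (Rn R n) -> \bar R},
    @lebesgue_Rn R n = mu.
Proof.
elim: n => [|m [mu IH]].
  pose H := Measure_isSigmaFinite.Build _ _ _ (\d_([tuple] : Rn R 0)).
  by exists (\d_([tuple] : Rn R 0)).
rewrite /= IH.
pose nu := (pushforward (@lebesgue_measure R \x mu) (@cons_pair m)).
have nus : sigma_finite setT nu.
  have /sigma_finiteP[F [TF ndF Foo]] :=
    sigma_finiteT (@lebesgue_measure R).
  have /sigma_finiteP[G [TG ndG Goo]] := sigma_finiteT mu.
  exists (fun k => @uncons_pair m @^-1` (F k `*` G k)).
    apply/seteqP; split => // x _.
    have [i _ Fi] : (\bigcup_i F i) (thead x) by rewrite -TF.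
    have [j _ Gj] : (\bigcup_i G i) [tuple of behead x] by rewrite -TG.
    exists (maxn i j) => //; split => /=.
      by move: Fi; apply/subsetPset/ndF/leq_maxl.
    by move: Gj; apply/subsetPset/ndG/leq_maxr.
  move=> k; have [mF Fk] := Foo k; have [mG Gk] := Goo k; split.
    by rewrite -[X in measurable X]setTI; apply: measurable_uncons_pair => //;
      exact: measurableX.
  rewrite /nu /pushforward [X in (_ \x _) X](_ : _ = F k `*` G k).
    by rewrite product_measure1E// lte_mul_pinfty// ge0_fin_numE.
  by apply/seteqP; split => z; rewrite /preimage /mkset cons_pairK.
have [nuM nuE] : exists nuM : {measure set (Rn R m.+1) -> \bar R},
    nu = nuM.
  unshelve refine (ex_intro _ (_ : {measure set (Rn R m.+1) -> \bar R}) _).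
    refine (pushforward (@lebesgue_measure R \x mu) (@cons_pair m)).
    exact: measurable_cons_pair.
  by [].
rewrite nuE in nus *.
have [nuS nuSE] := sigma_finite_structure nus.
by exists nuS; rewrite nuSE -nuE.
Qed.

(** Fubini for null sets: the measure of N is also the integral over y of the
    measure of the section of N at y, so that this section is null for almost
    every y. *)
Lemma lebesgue_Rn_null_section m (N : set (Rn R m.+1)) :
  measurable N -> lebesgue_Rn N = 0 ->
  exists N' : set (Rn R m), [/\ measurable N', lebesgue_Rn N' = 0 &
    forall y, ~ N' y ->
      let S := [set x : measurableTypeR R | N [tuple of x :: y]] in
      measurable S /\ @lebesgue_measure R S = 0].
Proof.
move=> mN; rewrite /=; have [mu ->] := lebesgue_Rn_sigma_finite m => N0.
pose A := @cons_pair m @^-1` N.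
have mA : measurable A by rewrite -[A]setTI; exact: measurable_cons_pair.
have A0 : (@lebesgue_measure R \x^ mu) A = 0.
  rewrite -[LHS](product_measure_unique (m1 := @lebesgue_measure R) (m2 := mu))//=.
  by move=> B C mB mC; exact: product_measure2E.
have mphi : measurable_fun setT (@lebesgue_measure R \o ysection A).
  exact: measurable_fun_ysection.
have : \int[mu]_y `|(@lebesgue_measure R \o ysection A) y| = 0.
  by under eq_integral do rewrite gee0_abs//.
move/(ae_eq_integral_abs mu measurableT mphi) => [N' [mN' N'0 HN']].
exists N'; split => // y N'y.
have mS : measurable (ysection A y) by exact: measurable_ysection.
have SE : [set x : measurableTypeR R | N [tuple of x :: y]] = ysection A y.
  by apply/seteqP; split => x; rewrite ysectionE.
rewrite SE; split => //.
by apply: contrapT => /= H; apply: N'y; apply: HN' => /= /(_ I).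
Qed.

End LebesgueRn.

Section IteratedNorm.
Variable R : realType.
Local Open Scope ereal_scope.

Lemma iterated_Lnorm_ge0 n (p : n.-tuple R) (g : Rn R n -> \bar R) :
  (forall x, 0 <= g x) -> 0 <= iterated_Lnorm p g.
Proof.
elim: n p g => [|n IH] p g g0 /=; first exact: g0.
by apply: IH => y; exact: Lnorm_ge0.
Qed.

Lemma tnth_behead_gt n (p : n.+1.-tuple R) (a : R) :
  (forall i, a < tnth p i)%R ->
  (a < thead p)%R /\ (forall i, a < tnth [tuple of behead p] i)%R.
Proof. by move=> h; split=> [|i]; [exact: h|rewrite tnth_behead; exact: h]. Qed.

(** By induction on the dimension: off a null set of y the section of N at y is
    null, and there the inner norms compare. *)
Lemma le_iterated_Lnorm_off_null n (p : n.-tuple R) (N : set (Rn R n))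
    (f g : Rn R n -> \bar R) :
    (forall i, 0 < tnth p i)%R ->
    measurable N -> lebesgue_Rn N = 0 ->
    (forall x, 0 <= f x) -> (forall x, 0 <= g x) ->
    (forall x, ~ N x -> f x <= g x) ->
  iterated_Lnorm p f <= iterated_Lnorm p g.
Proof.
elim: n p N f g => [|n IH] p N f g p0 mN N0 f0 g0 fg /=.
  apply: fg => Nx; move: N0; rewrite /= diracE mem_set//= => /eqP.
  by rewrite onee_eq0.
have [p00 p0'] := tnth_behead_gt p0.
have [N' [mN' N'0 NN']] := lebesgue_Rn_null_section mN N0.
apply: (IH _ N') => // [x|x|y N'y]; try exact: Lnorm_ge0.
have [mS S0] := NN' y N'y.
apply: (le_Lnorm_off_null p00 mS S0) => [x|x|x Sx]; [exact: f0|exact: g0|].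
exact: fg.
Qed.

Lemma le_iterated_Lnorm n (p : n.-tuple R) (f g : Rn R n -> \bar R) :
    (forall i, 0 < tnth p i)%R ->
    (forall x, 0 <= f x) -> (forall x, f x <= g x) ->
  iterated_Lnorm p f <= iterated_Lnorm p g.
Proof.
move=> p0 f0 fg; apply: (@le_iterated_Lnorm_off_null _ _ set0) => //.
  by have [mu ->] := lebesgue_Rn_sigma_finite R n; rewrite measure0.
by move=> x; exact: le_trans (fg x).
Qed.

End IteratedNorm.

(** * The countable triangle inequality *)

Section Minkowski.
Context d (T : measurableType d) (R : realType).
Variable mu : {measure set T -> \bar R}.
Local Open Scope ereal_scope.

Lemma poweRK (r : R) (x : \bar R) : r != 0%R -> 0 <= x ->
  (x `^ r) `^ r^-1 = x.
Proof. by move=> r0 x0; rewrite -poweRrM mulfV// poweRe1. Qed.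

Lemma poweRVK (r : R) (x : \bar R) : r != 0%R -> 0 <= x ->
  (x `^ r^-1) `^ r = x.
Proof. by move=> r0 x0; rewrite -poweRrM mulVf// poweRe1. Qed.

Lemma measurable_poweR_comp (r : R) (f : T -> \bar R) :
  measurable_fun setT f -> measurable_fun setT (fun x => f x `^ r).
Proof. by move=> mf; exact: (measurableT_comp (measurable_poweR r)). Qed.

(** The form of the continuity of x |-> x ^ r along partial sums that monotone
    convergence requires; it is obtained by comparing r-th roots, which avoids
    treating infinite values apart. *)
Lemma poweR_nneseries_le (r : R) (u : (\bar R)^nat) : (0 < r)%R ->
    (forall n, 0 <= u n) ->
  (\sum_(k <oo) u k) `^ r <= limn (fun n => (\sum_(0 <= k < n) u k) `^ r).
Proof.
move=> r0 u0; set L := leRHS.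
have ndS : {homo (fun n => \sum_(0 <= k < n) u k) : m n / (m <= n)%N >-> m <= n}.
  by move=> m n mn; exact: lee_sum_nneg_natr.
have nd : nondecreasing_seq (fun n => (\sum_(0 <= k < n) u k) `^ r).
  move=> m n mn; apply: le_poweR; [exact: ltW|exact: sume_ge0|exact: ndS].
have SL n : (\sum_(0 <= k < n) u k) `^ r <= L.
  have -> : L = _ := cvg_lim (@ereal_hausdorff R) (ereal_nondecreasing_cvgn nd).
  by apply: ereal_sup_ubound; exists n.
have L0 : 0 <= L by apply: le_trans (SL 0%N); exact: poweR_ge0.
rewrite -[leRHS](@poweRVK r)// ?gt_eqF//; apply: le_poweR; first exact: ltW.
  exact: nneseries_ge0.
apply: lime_le; first exact: is_cvg_nneseries.
apply: nearW => n; rewrite -[leLHS](@poweRK r) ?gt_eqF//; last exact: sume_ge0.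
by apply: le_poweR; [rewrite invr_ge0 ltW|exact: poweR_ge0|exact: SL].
Qed.

Lemma Lnorm_fin_ae (r : R) (f : T -> \bar R) : (0 < r)%R ->
    measurable_fun setT f -> Lnorm mu r%:E f < +oo ->
  exists N, [/\ measurable N, mu N = 0 & forall x, ~ N x -> f x \is a fin_num].
Proof.
move=> r0 mf foo.
have mfr : measurable_fun setT (fun x => `|f x| `^ r).
  by apply: measurable_poweR_comp; exact: measurableT_comp.
have : mu.-integrable setT (fun x => `|f x| `^ r).
  apply/integrableP; split => //.
  under eq_integral do rewrite gee0_abs ?poweR_ge0//.
  by rewrite -poweR_Lnorm ?gt_eqF//; exact: poweR_lty.
move/(integrable_ae measurableT) => [N [mN N0 HN]].
exists N; split => // x; apply: contra_notP => fx; apply: HN => /= /(_ I).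
move=> h; apply: fx; rewrite -abse_fin_num ge0_fin_numE//.
by apply: (@lty_poweRy _ _ r); rewrite ?gt_eqF//; move: h;
  rewrite fin_numElt => /andP[].
Qed.

(** If both norms are finite then f and g are finite almost everywhere, and the
    real-valued Minkowski inequality applies to their finite parts. *)
Lemma Lnorm_triangle (p : R) (f g : T -> \bar R) : (1 <= p)%R ->
    measurable_fun setT f -> measurable_fun setT g ->
    (forall x, 0 <= f x) -> (forall x, 0 <= g x) ->
  Lnorm mu p%:E (f \+ g) <= Lnorm mu p%:E f + Lnorm mu p%:E g.
Proof.
move=> p1 mf mg f0 g0; have p0 : (0 < p)%R by exact: lt_le_trans p1.
have [foo|] := boolP (Lnorm mu p%:E f < +oo); last first.
  rewrite -leNgt leye_eq => /eqP ->; rewrite addye ?leey// -ltNye.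
  exact: lt_le_trans (Lnorm_ge0 _ _ _).
have [goo|] := boolP (Lnorm mu p%:E g < +oo); last first.
  rewrite -leNgt leye_eq => /eqP ->; rewrite addey ?leey// -ltNye.
  exact: lt_le_trans (Lnorm_ge0 _ _ _).
have [N [mN N0 fN]] := Lnorm_fin_ae p0 mf foo.
have [M [mM M0 gM]] := Lnorm_fin_ae p0 mg goo.
have mNM : measurable (N `|` M) by exact: measurableU.
have NM0 : mu (N `|` M) = 0 by exact: null_set_setU.
have fineE (h : T -> \bar R) x : (forall x, 0 <= h x) -> 0 <= (fine (h x))%:E.
  by move=> h0; rewrite lee_fin fine_ge0.
have fine_le (h : T -> \bar R) : (forall x, 0 <= h x) ->
    Lnorm mu p%:E (EFin \o (fine \o h)) <= Lnorm mu p%:E h.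
  move=> h0; apply: (le_Lnorm_off_null p0 measurable0); rewrite ?measure0// => x.
    exact: fineE.
  by move=> _ /=; case: (h x) (h0 x) => //= _; rewrite leey.
apply: (@le_trans _ _ (Lnorm mu p%:E (EFin \o ((fine \o f) \+ (fine \o g))%R))).
  apply: (le_Lnorm_off_null p0 mNM NM0) => x.
  - exact: adde_ge0.
  - by rewrite lee_fin addr_ge0// fine_ge0.
  - move=> /not_orP[/fN fx /gM gx].
    by rewrite /= EFinD !fineK.
apply: (le_trans (minkowski_EFin _ _ _ p1)).
- by apply: measurableT_comp.
- by apply: measurableT_comp.
by apply: leeD; exact: fine_le.
Qed.

Lemma Lnorm_sum (p : R) (F : nat -> T -> \bar R) n : (1 <= p)%R ->
    (forall k, measurable_fun setT (F k)) -> (forall k x, 0 <= F k x) ->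
  Lnorm mu p%:E (fun x => \sum_(0 <= k < n) F k x)
    <= \sum_(0 <= k < n) Lnorm mu p%:E (F k).
Proof.
move=> p1 mF F0; elim: n => [|n IH].
  rewrite big_nil (@eq_Lnorm _ _ _ _ _ _ (cst 0)) ?Lnorm0//.
    by rewrite eqe gt_eqF// (lt_le_trans _ p1).
  by move=> x; rewrite big_nil.
rewrite big_nat_recr//=.
rewrite (@eq_Lnorm _ _ _ _ _ _ ((fun x => \sum_(0 <= k < n) F k x) \+ F n)).
  apply: (le_trans (Lnorm_triangle p1 _ _ _ _)) => //.
  - exact: emeasurable_sum.
  - by move=> x; exact: sume_ge0.
  - exact: leeD.
by move=> x; rewrite big_nat_recr.
Qed.

(** Partial sums satisfy the finite triangle inequality; monotone convergence
    passes to the limit in the p-th powers. *)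
Lemma Lnorm_nneseries (p : R) (F : nat -> T -> \bar R) : (1 <= p)%R ->
    (forall k, measurable_fun setT (F k)) -> (forall k x, 0 <= F k x) ->
  Lnorm mu p%:E (fun x => \sum_(k <oo) F k x)
    <= \sum_(k <oo) Lnorm mu p%:E (F k).
Proof.
move=> p1 mF F0; have p0 : (0 < p)%R by exact: lt_le_trans p1.
set c := leRHS.
have c0 : 0 <= c by apply: nneseries_ge0 => k _ _; exact: Lnorm_ge0.
pose S n x := (\sum_(0 <= k < n) F k x) `^ p.
have mS n : measurable_fun setT (S n).
  by apply: measurable_poweR_comp; exact: emeasurable_sum.
have S0 n x : 0 <= S n x by exact: poweR_ge0.
have ndS x : nondecreasing_seq (S ^~ x).
  move=> m n mn; apply: le_poweR; [exact: ltW|exact: sume_ge0|].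
  exact: lee_sum_nneg_natr.
have intS n : \int[mu]_x S n x <= c `^ p.
  have -> : \int[mu]_x S n x =
      Lnorm mu p%:E (fun x => \sum_(0 <= k < n) F k x) `^ p.
    rewrite poweR_Lnorm ?gt_eqF//; apply: eq_integral => x _.
    by rewrite gee0_abs//; exact: sume_ge0.
  apply: le_poweR; [exact: ltW|exact: Lnorm_ge0|].
  apply: (le_trans (Lnorm_sum _ p1 mF F0)).
  by apply: nneseries_lim_ge => k _ _; exact: Lnorm_ge0.
rewrite -(@poweRK p c) ?gt_eqF// unlock; apply: le_poweR.
- by rewrite invr_ge0 ltW.
- by apply: integral_ge0 => x _; exact: poweR_ge0.
apply: (@le_trans _ _ (\int[mu]_x limn (S ^~ x))).
  apply: (@le_integral_off_null _ _ _ mu _ _ set0); rewrite ?measure0// => x.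
  - exact: poweR_ge0.
  - apply: lime_ge; first exact: ereal_nondecreasing_is_cvgn.
    exact: nearW.
  - move=> _; rewrite gee0_abs; last exact: nneseries_ge0.
    exact: poweR_nneseries_le.
rewrite monotone_convergence//.
apply: lime_le; last exact: nearW.
apply: ereal_nondecreasing_is_cvgn => m n mn.
apply: ge0_le_integral => // x _; exact: ndS.
Qed.


End Minkowski.

Section IteratedMinkowski.
Variable R : realType.
Local Open Scope ereal_scope.

Lemma measurable_Lnorm_section n (p : R) (g : Rn R n.+1 -> \bar R) :
    measurable_fun setT g ->
  measurable_fun setT
    (fun y : Rn R n => Lnorm (@lebesgue_measure R) p%:E
      (fun x => g [tuple of x :: y])).
Proof.
move=> mg; rewrite unlock; apply: measurable_poweR_comp.
apply: (@measurable_fun_fubini_tonelli_G _ _ (measurableTypeR R) (Rn R n) R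
  (@lebesgue_measure R) (fun z => `|g (cons_pair z)| `^ p)).
  apply: measurable_poweR_comp; apply: measurableT_comp => //.
  by apply: measurableT_comp => //; exact: measurable_cons_pair.
by move=> z; exact: poweR_ge0.
Qed.

(** One application of [Lnorm_nneseries] for each coordinate.  The functions
    that appear after integrating out the first coordinates can take infinite
    values, hence the extended-real setting. *)
Lemma iterated_Lnorm_nneseries n (p : n.-tuple R) (F : nat -> Rn R n -> \bar R) :
    (forall i, 1 <= tnth p i)%R ->
    (forall k, measurable_fun setT (F k)) -> (forall k x, 0 <= F k x) ->
  iterated_Lnorm p (fun x => \sum_(k <oo) F k x)
    <= \sum_(k <oo) iterated_Lnorm p (F k).
Proof.
elim: n p F => [|n IH] p F p1 mF F0 //=.
have p1' i : (1 <= tnth [tuple of behead p] i)%R by rewrite tnth_behead.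
have mFy k (y : Rn R n) :
    measurable_fun setT (fun x : measurableTypeR R => F k [tuple of x :: y]).
  apply: measurableT_comp => //.
  by apply: measurable_cons => //; exact: measurable_cst.
apply: le_trans (IH _ _ p1' _ _) => [|k|k y]; last 2 first.
- exact: measurable_Lnorm_section.
- exact: Lnorm_ge0.
apply: le_iterated_Lnorm => [i|y|y].
- exact: lt_le_trans (p1' i).
- exact: Lnorm_ge0.
- by apply: Lnorm_nneseries => //; exact: p1.
Qed.

End IteratedMinkowski.

(** * Lebesgue measurable functions and dyadic annuli *)

Section Completion.
Context d (T : measurableType d) (R : realType).
Variable mu : {measure set T -> \bar R}.

(** The sets that become Borel after removing a Borel null set form a
    sigma-algebra containing the generators A `|` N of the completion. *)
Lemma completed_set_borel (E : set T) :
    (completed_algebra_gen mu).-sigma.-measurable E ->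
  exists N, [/\ measurable N, mu N = 0%E & measurable (E `\` N)].
Proof.
pose G := [set E : set T | exists N,
  [/\ measurable N, mu N = 0%E & measurable (E `\` N)]].
suff : (completed_algebra_gen mu).-sigma.-measurable `<=` G by apply.
apply: smallest_sub => [|_ [A mA [N [M [mM M0 NM]] <-]]]; last first.
  exists M; split => //; rewrite setDUl [N `\` M](_ : _ = set0) ?setU0.
    exact: measurableD.
  by apply/seteqP; split => // x [/NM Mx nMx].
split.
- by exists set0; split; rewrite ?measure0// set0D.
- move=> A [N [mN N0 mA]]; exists N; split => //.
  have -> : ([set: T] `\` A) `\` N = ~` (A `\` N) `\` N.
    by apply/seteqP; split => x /=; tauto.
  by apply: measurableD => //; exact: measurableC.
- move=> F FG; pose N k := projT1 (cid (FG k)).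
  have NP k : [/\ measurable (N k), mu (N k) = 0%E & measurable (F k `\` N k)].
    by rewrite /N; case: cid.
  have mUN : measurable (\bigcup_k N k).
    by apply: bigcup_measurable => k _; have [] := NP k.
  exists (\bigcup_k N k); split => //.
    apply/negligibleP => //; apply: negligible_bigcup => k.
    by have [mk k0 _] := NP k; exact/negligibleP.
  rewrite setD_bigcupl; apply: bigcup_measurable => k _.
  have -> : F k `\` \bigcup_k N k = (F k `\` N k) `\` \bigcup_k N k.
    apply/seteqP; split => x [Fx Nx]; split => //; last by case: Fx.
    by split => // Nkx; apply: Nx; exists k.
  by apply: measurableD => //; have [] := NP k.
Qed.

(** Each superlevel set of f at a rational level is Borel off a null set; the
    union of these countably many null sets works for all levels. *)
Lemma completed_fun_borel (f : T -> R) :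
    measurable_fun [set: g_sigma_algebraType (completed_algebra_gen mu)]
      (f : g_sigma_algebraType (completed_algebra_gen mu) -> measurableTypeR R) ->
  exists N, [/\ measurable N, mu N = 0%E &
    measurable_fun [set: T] (fun x => f x * \1_(~` N) x)].
Proof.
move=> mf.
(* q enumerates the rationals *)
pose q (k : nat) : R := ratr (odflt 0 (unpickle k : option rat)).
have H k : exists N, [/\ measurable N, mu N = 0%E &
    measurable ([set x | q k < f x] `\` N)].
  apply: completed_set_borel.
  have := mf measurableT `]q k, +oo[%classic (measurable_itv _).
  rewrite setTI; congr (_ _); apply/seteqP; split => x /=;
  by rewrite in_itv/= andbT.
pose N k := projT1 (cid (H k)).
have NP k : [/\ measurable (N k), mu (N k) = 0%E &
    measurable ([set x | q k < f x] `\` N k)].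
  by rewrite /N; case: cid.
have mUN : measurable (\bigcup_k N k).
  by apply: bigcup_measurable => k _; have [] := NP k.
exists (\bigcup_k N k); split => //.
  apply/negligibleP => //; apply: negligible_bigcup => k.
  by have [mk k0 _] := NP k; exact/negligibleP.
set U := \bigcup_k N k.
have mfU (y : R) : measurable ([set x | y < f x] `\` U).
  have -> : [set x | y < f x] `\` U =
      \bigcup_(k in [set k | y < q k]) (([set x | q k < f x] `\` N k) `\` U).
    apply/seteqP; split => x.
      move=> [/= yf Ux]; have [a] := rat_in_itvoo yf.
      rewrite in_itv/= => /andP[ya af].
      exists (pickle a); rewrite /= /q pickleK//=; split => //; split => //.
      by move=> Nx; apply: Ux; exists (pickle a).
    by move=> [k /= yq [[qf _] Ux]]; split => //=; exact: lt_trans qf.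
  apply: bigcup_measurable => k _; apply: measurableD => //.
  by have [] := NP k.
apply: (measurability _ (RGenOInfty.measurableE R)).
move=> _ [_ [y ->] <-]; rewrite setTI.
have [y0|y0] := ltP y 0.
  have -> : (fun x => f x * \1_(~` U) x) @^-1` `]y, +oo[ =
      ([set x | y < f x] `\` U) `|` U.
    apply/seteqP; split => x /=; rewrite in_itv/= andbT indicE.
      have [Ux _|Ux] := pselect (U x); first by right.
      by rewrite mem_set// mulr1; left.
    move=> [[yf Ux]|Ux]; first by rewrite mem_set// mulr1.
    by rewrite memNset ?mulr0// => /(_ Ux).
  exact: measurableU.
have -> : (fun x => f x * \1_(~` U) x) @^-1` `]y, +oo[ = [set x | y < f x] `\` U.
  apply/seteqP; split => x /=; rewrite in_itv/= andbT indicE.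
    have [Ux|Ux] := pselect (U x).
      by rewrite memNset ?mulr0; [rewrite ltNge y0|move/(_ Ux)].
    by rewrite mem_set// mulr1.
  by move=> [yf Ux]; rewrite mem_set// mulr1.
exact: mfU.
Qed.

End Completion.

Section Geometry.
Variable R : realType.

Lemma measurable_sqrt : measurable_fun setT (@Num.sqrt R : R -> R).
Proof. by apply: continuous_measurable_fun; exact: sqrt_continuous. Qed.

Lemma measurable_enorm n : measurable_fun [set: Rn R n] (@enorm R n : Rn R n -> R).
Proof.
apply: (measurableT_comp measurable_sqrt).
apply: measurable_sum => i; apply: measurable_funX.
exact: (@measurable_tnth _ (measurableTypeR R)).
Qed.

Lemma measurable_annulus n j : measurable (@dyadic_annulus R n j).
Proof.
have mb k : measurable (@dyadic_ball R n k).
  have := @measurable_enorm n measurableT `]-oo, 2 ^ k]%classic (measurable_itv _).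
  rewrite setTI; congr (_ _); apply/seteqP; split => x /=;
  by rewrite in_itv.
exact: measurableD.
Qed.

Lemma annulus_oball n (j : int) (r : R) : 2 ^ j < r ->
  @dyadic_annulus R n j `<=` @oball R n r.
Proof. by move=> jr x [/= xj _]; exact: le_lt_trans jr. Qed.

(** The index i is the predecessor of the least k with 2^(J-k) < e, where k = 0
    is excluded by e <= 2^J. *)
Lemma dyadic_shell (e : R) (J : int) : 0 < e -> e <= 2 ^ J ->
  exists i : nat, e <= 2 ^ (J - i%:Z) /\ 2 ^ (J - i%:Z - 1) < e.
Proof.
move=> e0 eJ.
have ex : exists k : nat, 2 ^ (J - k%:Z) < e.
  exists (Num.bound (2 ^ J / e)).
  rewrite expfzDr// -invr_expz -exprnP.
  have c0 : 0 < 2 ^ J :> R by rewrite exprz_gt0.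
  have := upper_nthrootP (leqnn (Num.bound (2 ^ J / e))).
  by rewrite ltr_pdivrMr// ltr_pdivrMr ?exprn_gt0// mulrC.
have [k ke kmin] := ex_minnP ex.
case: k ke kmin => [|i] ke kmin.
  by move: ke; rewrite subr0 ltNge eJ.
exists i; split.
  by rewrite leNgt; apply/negP => /kmin; rewrite ltnn.
by move: ke; rewrite -(addn1 i) PoszD opprD addrA.
Qed.

Lemma enorm_thead n (x : Rn R n.+1) : enorm x = 0 -> thead x = 0 :> R.
Proof.
move/eqP; rewrite /enorm sqrtr_eq0 => h.
apply/eqP; rewrite -sqrf_eq0 eq_le sqr_ge0 andbT; apply: le_trans h.
by rewrite (bigD1 ord0)//= lerDl; apply: sumr_ge0 => i _; exact: sqr_ge0.
Qed.

(** The origin is discarded through a coordinate hyperplane containing it,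
    whose preimage under (x, y) |-> x :: y is a product set. *)
Lemma hyperplane_null n :
  measurable [set x : Rn R n.+1 | thead x = 0 :> R] /\
  lebesgue_Rn [set x : Rn R n.+1 | thead x = 0 :> R] = 0%E.
Proof.
split.
  have := @measurable_tnth _ (measurableTypeR R) n.+1 ord0 measurableT [set 0]
    (measurable_set1 _).
  by rewrite setTI.
rewrite /=; have [mu ->] := lebesgue_Rn_sigma_finite R n.
rewrite /pushforward [X in (_ \x _)%E X](_ : _ = [set 0 : measurableTypeR R] `*` setT).
  transitivity (@lebesgue_measure R [set 0%R : R] * mu setT)%E.
    exact: product_measure1E.
  by rewrite lebesgue_measure_set1 mul0e.
by apply/seteqP; split => -[a b] /=; rewrite theadE; tauto.
Qed.

End Geometry.

Section LocalNorms.
Variable R : realType.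

Lemma normc_ge0 (z : R[i]) : 0 <= Normc.normc z.
Proof. by case: z => a b; exact: sqrtr_ge0. Qed.

Lemma normc_indic n (f : Rn R n -> R[i]) (E : set (Rn R n)) x :
  Normc.normc (f x * \1_E x) = Normc.normc (f x) * \1_E x.
Proof.
rewrite !indicE; case: (_ \in _); first by rewrite !mulr1.
by rewrite !mulr0 Normc.normc0.
Qed.

(** Vanishing at the origin matters because the dyadic annuli cover only the
    complement of the origin. *)
Lemma borel_modulus n (f : Rn R n.+1 -> R[i]) : lebesgue_measurable f ->
  exists (h : Rn R n.+1 -> R) (N : set (Rn R n.+1)),
    [/\ measurable_fun setT h, (forall x, 0 <= h x),
       (forall x, enorm x = 0 -> h x = 0) &
       [/\ measurable N, lebesgue_Rn N = 0%E &
        forall x, ~ N x -> h x = Normc.normc (f x)]].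
Proof.
move=> [mRe mIm].
have mn : measurable_fun [set: cRn R n.+1]
    ((fun x => Normc.normc (f x)) : cRn R n.+1 -> measurableTypeR R).
  rewrite (_ : (fun x => _) = (fun x => Num.sqrt
      (complex.Re (f x) ^+ 2 + complex.Im (f x) ^+ 2))); last first.
    by apply/funext => x; case: (f x).
  apply: (measurableT_comp (@measurable_sqrt R)).
  by apply: measurable_funD; apply: measurable_funX.
have [mu muE] := lebesgue_Rn_sigma_finite R n.+1.
have [mH H0] := hyperplane_null R n.
move: mn; rewrite muE in H0 * => /completed_fun_borel[N [mN N0 mh]].
set H := [set x : Rn R n.+1 | thead x = 0 :> R] in mH H0 *.
exists (fun x => Normc.normc (f x) * \1_(~` N) x * \1_(~` H) x), (N `|` H).
split.
- apply: measurable_funM => //; apply: measurable_indic.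
  exact: measurableC.
- move=> x; rewrite !indicE; apply: mulr_ge0 => //; apply: mulr_ge0 => //.
  exact: normc_ge0.
- move=> x ex0; have Hx : H x by exact: enorm_thead.
  by rewrite [X in _ * X]indicE memNset ?mulr0// => /(_ Hx).
split; [exact: measurableU|exact: null_set_setU|].
by move=> x /not_orP[Nx Hx]; rewrite !indicE !mem_set// !mulr1.
Qed.

(** Isolates the geometry: a ball contains the annuli of smaller radius, and is
    covered by annuli up to a null set.  These two bounds turn the comparison
    into one between a sequence and a function of the radius. *)
Lemma local_norms n (p : n.+1.-tuple R) (f : Rn R n.+1 -> R[i]) :
    (forall i, 1 <= tnth p i) -> lebesgue_measurable f ->
  [/\ (forall j (r : R), 2 ^ j < r ->
        (mixed_norm_on p (@dyadic_annulus R n.+1 j) f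
         <= mixed_norm_on p (@oball R n.+1 r) f)%E) &
      (forall J (r : R), r <= 2 ^ J ->
        (mixed_norm_on p (@oball R n.+1 r) f <= \sum_(i <oo)
           mixed_norm_on p (@dyadic_annulus R n.+1 (J - i%:Z)) f)%E)].
Proof.
move=> p1 mf.
have p0 i : 0 < tnth p i by exact: lt_le_trans (p1 i).
have [h [N [mh h0 h00 [mN N0 hN]]]] := borel_modulus mf.
have hE0 E x : (0 <= (h x * \1_E x)%:E)%E by rewrite lee_fin mulr_ge0.
have fE0 E x : (0 <= (Normc.normc (f x * \1_E x))%:E)%E.
  by rewrite lee_fin normc_ge0.
have normE E : mixed_norm_on p E f = iterated_Lnorm p (fun x => (h x * \1_E x)%:E).
  apply/eqP; rewrite eq_le /mixed_norm_on /mixed_norm; apply/andP; split;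
    apply: (le_iterated_Lnorm_off_null p0 mN N0) => // x Nx;
    by rewrite normc_indic hN.
split => [j r jr|J r rJ].
  rewrite !normE; apply: le_iterated_Lnorm => // x.
  rewrite lee_fin ler_wpM2l// !indicE ler_nat.
  case: (boolP (x \in @dyadic_annulus _ _ _)) => //; rewrite inE => xA.
  by rewrite mem_set//; exact: annulus_oball xA.
rewrite normE; under eq_eseriesr do rewrite normE.
apply: le_trans (iterated_Lnorm_nneseries p1 _ _) => [|k|//]; last first.
  apply/measurable_EFinP; apply: measurable_funM => //.
  by apply: measurable_indic; exact: measurable_annulus.
apply: le_iterated_Lnorm => // x.
have S0 : (0 <= \sum_(k <oo) (h x * \1_(@dyadic_annulus R n.+1 (J - k%:Z)) x)%:E)%E.
  exact: nneseries_ge0.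
have [xr|xr] := boolP (x \in @oball R n.+1 r); last first.
  by rewrite [in leLHS]indicE (negbTE xr) mulr0.
have : 0 <= enorm x by exact: sqrtr_ge0.
rewrite le_eqVlt => /predU1P[/esym/h00 hx0|x0];
  first by rewrite [in leLHS]hx0 mul0r.
have [|i [xi xi1]] := @dyadic_shell R (enorm x) J x0.
  by move: xr; rewrite inE => /ltW/le_trans; exact.
have xA : x \in @dyadic_annulus R n.+1 (J - i%:Z).
  by rewrite inE; split => //=; apply/negP; rewrite -ltNge.
apply: le_trans (nneseries_lim_ge i.+1 _) => [|k _ _]; last exact: hE0.
rewrite big_nat_recr//= -[leLHS]add0e; apply: leeD.
  by apply: sume_ge0 => k _; exact: hE0.
by rewrite !indicE xr xA.
Qed.

End LocalNorms.

(** * Sequences over the integers and dyadic integrals *)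

Definition int_of_code (n : nat) : int := if odd n then Negz n./2 else Posz n./2.

Definition code_of_int (z : int) : nat :=
  match z with Posz k => k.*2 | Negz k => k.*2.+1 end.

Lemma int_of_codeK : cancel int_of_code code_of_int.
Proof.
move=> n; rewrite /int_of_code -[RHS](odd_double_half n).
by case: (odd n).
Qed.

Lemma code_of_intK : cancel code_of_int int_of_code.
Proof.
by case=> k; rewrite /int_of_code /= odd_double /= ?uphalf_double ?doubleK.
Qed.

Lemma int_of_code_bij : set_bij [set: nat] [set: int] int_of_code.
Proof.
rewrite setTT_bijective.
by exists code_of_int; [exact: int_of_codeK|exact: code_of_intK].
Qed.

Section SequenceNorm.
Variable R : realType.
Local Open Scope ereal_scope.
Implicit Types (b : int -> \bar R) (t : R).

(** Enumerating the integers turns unordered sums into series and makes the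
    l^t norm an L^t norm for the counting measure on the natural numbers. *)
Lemma esum_int b : (forall j, 0 <= b j) ->
  \esum_(j in [set: int]) b j = \sum_(n <oo) b (int_of_code n).
Proof.
move=> b0; rewrite (reindex_esum _ _ _ _ int_of_code_bij).
by rewrite nneseries_esumT.
Qed.

Definition ell t b : \bar R := (\esum_(j in [set: int]) b j `^ t) `^ t^-1.

Lemma ell_Lnorm t b : (0 < t)%R -> (forall j, 0 <= b j) ->
  ell t b = Lnorm (@counting nat R) t%:E (b \o int_of_code).
Proof.
move=> t0 b0; rewrite Lnorm_counting// /ell esum_int; last first.
  by move=> j; exact: poweR_ge0.
congr (_ `^ _); apply: eq_eseriesr => n _.
by rewrite /= gee0_abs.
Qed.

Lemma ell_ge0 t b : 0 <= ell t b.
Proof. exact: poweR_ge0. Qed.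

Lemma ell_shift t b (k : int) : ell t (fun j => b (j + k)%R) = ell t b.
Proof.
rewrite /ell; congr (_ `^ _).
rewrite [RHS](@reindex_esum R int int setT setT (fun j => j + k)%R)//.
rewrite setTT_bijective; exists (fun j => j - k)%R => j; first exact: addrK.
exact: subrK.
Qed.

Lemma ell_scale t (c : R) b : (0 < t)%R -> (0 <= c)%R -> (forall j, 0 <= b j) ->
  ell t (fun j => c%:E * b j) = c%:E * ell t b.
Proof.
move=> t0 c0 b0; rewrite /ell.
have cb j : 0 <= c%:E * b j by apply: mule_ge0.
under eq_esum do rewrite poweRM//.
rewrite !esum_int; last 2 first.
- by move=> j; exact: poweR_ge0.
- by move=> j; rewrite mule_ge0// poweR_ge0.
rewrite nneseriesZl; last by move=> i _; exact: poweR_ge0.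
rewrite poweRM; last 2 first.
- by rewrite lee_fin powR_ge0.
- by apply: nneseries_ge0 => n _ _; exact: poweR_ge0.
by rewrite -poweR_EFin poweRK// gt_eqF.
Qed.

(** Minkowski's inequality in l^t, as an instance of [Lnorm_nneseries] for the
    counting measure. *)
Lemma ell_nneseries t (F : nat -> int -> \bar R) : (1 <= t)%R ->
    (forall i j, 0 <= F i j) ->
  ell t (fun j => \sum_(i <oo) F i j) <= \sum_(i <oo) ell t (F i).
Proof.
move=> t1 F0; have t0 : (0 < t)%R by exact: lt_le_trans t1.
rewrite ell_Lnorm//; last by move=> j; exact: nneseries_ge0.
under eq_eseriesr do rewrite ell_Lnorm//.
by apply: Lnorm_nneseries => // i n; exact: F0.
Qed.

Lemma geometric_nneseries_le (c q : R) (x : \bar R) :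
    (0 < c)%R -> (0 < q < 1)%R -> 0 <= x ->
  \sum_(i <oo) ((c * q ^+ i)%:E * x) <= (c / (1 - q))%:E * x.
Proof.
move=> c0 /andP[q0 q1] x0.
have cq i : (0 <= c * q ^+ i)%R by rewrite mulr_ge0 ?exprn_ge0// ltW.
apply: lime_le.
  by apply: is_cvg_nneseries => i _ _; rewrite mule_ge0// lee_fin.
apply: nearW => n; rewrite -ge0_sume_distrl//; last by move=> i _; rewrite lee_fin.
rewrite sumEFin lee_wpmul2r// lee_fin -mulr_sumr ler_wpM2l ?(ltW c0)//.
rewrite -[leRHS]mul1r ler_pdivlMr ?subr_gt0//.
have -> : ((\sum_(0 <= i < n) q ^+ i) * (1 - q) = 1 - q ^+ n)%R.
  elim: n => [|n IH]; first by rewrite big_nil mul0r expr0 subrr.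
  by rewrite big_nat_recr//= mulrDl IH exprSr; ring.
by rewrite gerBl exprn_ge0// ltW.
Qed.

(** The discrete Hardy inequality: the left-hand side is the norm of a
    convolution of b with a geometric sequence.  By Minkowski's inequality it is
    at most the sum of c q^i times the norm of a shift of b, and shifts preserve
    the norm. *)
Lemma ell_geometric_average t (c q : R) b : (1 <= t)%R -> (0 < c)%R ->
    (0 < q < 1)%R -> (forall j, 0 <= b j) ->
  ell t (fun j => \sum_(i <oo) ((c * q ^+ i)%:E * b (j + 1 - i%:Z)%R))
    <= (c / (1 - q))%:E * ell t b.
Proof.
move=> t1 c0 q01 b0; have t0 : (0 < t)%R by exact: lt_le_trans t1.
have cq i : (0 <= c * q ^+ i)%R.
  by case/andP: q01 => q0 _; rewrite mulr_ge0 ?exprn_ge0// ltW.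
apply: (le_trans (ell_nneseries t1 _)) => [i j|].
  by rewrite mule_ge0// lee_fin.
apply: le_trans (geometric_nneseries_le c0 q01 (ell_ge0 t b)).
apply: lee_nneseries => [i _ _|i _]; first exact: ell_ge0.
rewrite ell_scale// -[in leRHS](ell_shift t b (1 - i%:Z)).
by under [in leRHS]eq_fun do rewrite addrA.
Qed.

End SequenceNorm.

Section DyadicIntegral.
Variable R : realType.
Local Open Scope ereal_scope.
Implicit Types (w : int -> \bar R) (phi : R -> \bar R).

Definition octave (j : int) : set R := `](2 ^ j)%R, (2 ^ (j + 1))%R]%classic.

Lemma octave_cover (r : R) : (0 < r)%R -> exists j, octave j r.
Proof.
move=> r0; have [|i [ri ir]] := @dyadic_shell R r (Num.bound r) r0.
  rewrite -exprnP; apply/ltW; apply: upper_nthrootP; exact: leqnn.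
exists ((Num.bound r)%:Z - i%:Z - 1)%R.
by rewrite /octave/= in_itv/= subrK ir.
Qed.

Lemma octave_inj (r : R) j k : octave j r -> octave k r -> j = k.
Proof.
wlog jk : j k / (j <= k)%R.
  move=> H jr kr; have [jk|/ltW kj] := leP j k; first exact: H.
  by apply/esym; exact: H.
rewrite /octave/= !in_itv/= => /andP[_ rj] /andP[kr _].
apply/eqP; rewrite eq_le jk/=.
have : (2 ^ k < 2 ^ (j + 1) :> R)%R by exact: lt_le_trans rj.
by rewrite ltr_eXz2l ?ltr1n// ltzD1.
Qed.

Lemma octave_gt0 (r : R) j : octave j r -> (0 < r)%R.
Proof.
by rewrite /octave/= in_itv/= => /andP[+ _]; apply: lt_trans; rewrite exprz_gt0.
Qed.

Lemma lebesgue_octave j : @lebesgue_measure R (octave j) = (2 ^ j)%:E.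
Proof.
rewrite /octave lebesgue_measure_itv/= lte_fin ltr_eXz2l ?ltr1n//.
by rewrite ltzD1 lexx -EFinB expfzDr// expr1z; congr EFin; ring.
Qed.

Definition dyadic_step w (r : R) : \bar R :=
  \sum_(n <oo) (w (int_of_code n) * (\1_(octave (int_of_code n)) r)%:E).

Lemma dyadic_step_in w r j : (forall k, 0 <= w k) -> octave j r ->
  dyadic_step w r = w j.
Proof.
move=> w0 rj; have w10 n :
    0 <= w (int_of_code n) * (\1_(octave (int_of_code n)) r)%:E.
  by rewrite mule_ge0// lee_fin.
rewrite /dyadic_step (nneseriesD1 (n := code_of_int j))//.
rewrite code_of_intK indicE mem_set// mule1 eseries0 ?adde0// => n _ /= nj.
rewrite indicE memNset ?mule0// => /(octave_inj rj) jn.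
by move: nj; rewrite jn int_of_codeK eqxx.
Qed.

Lemma dyadic_step_out w r : (r <= 0)%R -> dyadic_step w r = 0.
Proof.
move=> r0; rewrite /dyadic_step eseries0// => n _ _.
rewrite indicE memNset ?mule0// => /octave_gt0.
by rewrite ltNge r0.
Qed.

Lemma dyadic_step_ge0 w r : (forall k, 0 <= w k) -> 0 <= dyadic_step w r.
Proof. by move=> w0; apply: nneseries_ge0 => n _ _; rewrite mule_ge0// lee_fin. Qed.

Lemma integral_dyadic_step w : (forall k, 0 <= w k) ->
  \int[@lebesgue_measure R]_r dyadic_step w r
    = \esum_(j in [set: int]) (w j * (2 ^ j)%:E).
Proof.
move=> w0; have mI j : measurable (octave j) by exact: measurable_itv.
have m1 j : measurable_fun [set: R] (fun r => (\1_(octave j) r)%:E : \bar R).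
  by apply/measurable_EFinP; exact: measurable_indic.
rewrite /dyadic_step integral_nneseries//; last 2 first.
- by move=> n; apply: (@measurable_funeM _ _ _ _ _ (w (int_of_code n))); exact: m1.
- by move=> n r _; rewrite mule_ge0// lee_fin.
rewrite esum_int; last by move=> j; rewrite mule_ge0// lee_fin exprz_ge0.
apply: eq_eseriesr => n _.
rewrite ge0_integralZl//; last exact: m1.
congr (_ * _); rewrite -(lebesgue_octave (int_of_code n)).
transitivity (@lebesgue_measure R (octave (int_of_code n) `&` setT)).
  exact: (@integral_indic _ (measurableTypeR R) R (@lebesgue_measure R) setT
    measurableT _ (measurable_itv _)).
by rewrite setIT.
Qed.

(** Together with [dyadic_le_integral], compares the integral of phi with a sum
    over the octaves by means of a step function. *)
Lemma integral_le_dyadic w phi :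
    (forall j, 0 <= w j) -> (forall r, (0 < r)%R -> 0 <= phi r) ->
    (forall j r, octave j r -> phi r <= w j) ->
  \int[@lebesgue_measure R]_(r in `]0%R, +oo[) phi r
    <= \esum_(j in [set: int]) (w j * (2 ^ j)%:E).
Proof.
move=> w0 phi0 phiw; rewrite integral_mkcond -integral_dyadic_step//.
apply: (@le_integral_off_null _ _ _ _ _ _ set0); rewrite ?measure0// => r.
- by apply: erestrict_ge0 => x; rewrite /= in_itv/= andbT; exact: phi0.
- exact: dyadic_step_ge0.
move=> _; rewrite patchE; case: ifPn => [|_]; last exact: dyadic_step_ge0.
rewrite inE/= in_itv/= andbT => /octave_cover[j rj].
by rewrite (dyadic_step_in w0 rj) phiw.
Qed.

Lemma dyadic_le_integral w phi :
    (forall j, 0 <= w j) -> (forall r, (0 < r)%R -> 0 <= phi r) ->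
    (forall j r, octave j r -> w j <= phi r) ->
  \esum_(j in [set: int]) (w j * (2 ^ j)%:E)
    <= \int[@lebesgue_measure R]_(r in `]0%R, +oo[) phi r.
Proof.
move=> w0 phi0 wphi; rewrite integral_mkcond -integral_dyadic_step//.
apply: (@le_integral_off_null _ _ _ _ _ _ set0); rewrite ?measure0// => r.
- exact: dyadic_step_ge0.
- by apply: erestrict_ge0 => x; rewrite /= in_itv/= andbT; exact: phi0.
move=> _; rewrite patchE; case: ifPn => [|].
  rewrite inE/= in_itv/= andbT => /octave_cover[j rj].
  by rewrite (dyadic_step_in w0 rj) wphi.
rewrite notin_setE/= in_itv/= andbT => /negP; rewrite -leNgt => r0.
by rewrite dyadic_step_out.
Qed.

End DyadicIntegral.

Arguments octave {R} j.

(** * Comparison of the two norms *)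

Section Comparison.
Variable R : realType.
Local Open Scope ereal_scope.
Variables (c q : R) (b : int -> \bar R) (G : R -> \bar R).
Hypotheses (c0 : (0 < c)%R) (q01 : (0 < q < 1)%R).
Hypotheses (b0 : forall j, 0 <= b j) (G0 : forall r, 0 <= G r).
Hypothesis bG : forall j r, octave j r -> b j <= c%:E * G r.
Hypothesis Gb : forall j r, octave j r ->
  G r <= \sum_(i <oo) ((c * q ^+ i)%:E * b (j + 1 - i%:Z)%R).

Let cq i : (0 <= c * q ^+ i)%R.
Proof. by case/andP: q01 => q0 _; rewrite mulr_ge0 ?exprn_ge0// ltW. Qed.

(** On the octave of index j one has 1/r <= 2^(-j), and the length 2^j of the
    octave cancels this factor; what is left is the l^t norm of the geometric
    averages bounding G. *)
Lemma integral_le_ell (t : R) : (1 <= t)%R ->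
  (\int[@lebesgue_measure R]_(r in `]0%R, +oo[) (G r `^ t * r^-1%:E)) `^ t^-1
    <= (c / (1 - q))%:E * ell t b.
Proof.
move=> t1; have t0 : (0 < t)%R by exact: lt_le_trans t1.
apply: le_trans (ell_geometric_average t1 c0 q01 b0).
set V := fun j => \sum_(i <oo) _.
have V0 j : 0 <= V j by apply: nneseries_ge0 => i _ _; rewrite mule_ge0// lee_fin.
apply: le_poweR; first by rewrite invr_ge0 ltW.
  apply: integral_ge0 => r; rewrite /= in_itv/= andbT => r0.
  by rewrite mule_ge0 ?poweR_ge0// lee_fin invr_ge0 ltW.
rewrite (eq_esum (b := fun j => (V j `^ t * (2 ^ (- j))%:E) * (2 ^ j)%:E));
  last first.
  move=> j _; rewrite -muleA -EFinM -expfzDr// addNr expr0z mule1//.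
apply: integral_le_dyadic => [j|r r0|j r rj].
- by rewrite mule_ge0 ?poweR_ge0// lee_fin exprz_ge0.
- by rewrite mule_ge0 ?poweR_ge0// lee_fin invr_ge0 ltW.
have r0 := octave_gt0 rj.
apply: lee_pmul; rewrite ?poweR_ge0//.
- by rewrite lee_fin invr_ge0 ltW.
- by apply: le_poweR; [exact: ltW|exact: G0|exact: Gb].
rewrite lee_fin -invr_expz lef_pV2 ?posrE ?exprz_gt0//.
by move: rj; rewrite /octave/= in_itv/= => /andP[/ltW].
Qed.

(** On the octave of index j one has 1/r >= 2^(-j-1).  The lost factor 1/2 is
    absorbed by dividing b by 2c rather than by c, since (1/2)^t <= 1/2 for
    t >= 1; this keeps the constant independent of t. *)
Lemma ell_le_integral (t : R) : (1 <= t)%R ->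
  (2 * c)^-1%:E * ell t b <=
  (\int[@lebesgue_measure R]_(r in `]0%R, +oo[) (G r `^ t * r^-1%:E)) `^ t^-1.
Proof.
move=> t1; have t0 : (0 < t)%R by exact: lt_le_trans t1.
have c2 : (0 <= (2 * c)^-1)%R by rewrite invr_ge0 mulr_ge0// ltW.
rewrite -ell_scale// /ell; set B := fun j => (2 * c)^-1%:E * b j.
have B0 j : 0 <= B j by rewrite mule_ge0// lee_fin.
apply: le_poweR; first by rewrite invr_ge0 ltW.
  by apply: esum_ge0 => j _; exact: poweR_ge0.
rewrite (eq_esum (b := fun j => (B j `^ t * (2 ^ (- j))%:E) * (2 ^ j)%:E));
  last first.
  move=> j _; rewrite -muleA -EFinM -expfzDr// addNr expr0z mule1//.
apply: dyadic_le_integral => [j|r r0|j r rj].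
- by rewrite mule_ge0 ?poweR_ge0// lee_fin exprz_ge0.
- by rewrite mule_ge0 ?poweR_ge0// lee_fin invr_ge0 ltW.
have r0 := octave_gt0 rj.
have BG : B j <= 2^-1%:E * G r.
  rewrite /B invfM EFinM -muleA lee_wpmul2l ?lee_fin//.
  by rewrite lee_pdivrMl//; exact: bG.
apply: (@le_trans _ _ ((2^-1%:E * G r `^ t) * (2 ^ (- j))%:E)).
  apply: lee_wpmul2r; first by rewrite lee_fin exprz_ge0.
  apply: (le_trans (le_poweR (ltW t0) (B0 j) BG)).
  rewrite poweRM// lee_wpmul2r ?poweR_ge0// lee_fin.
  by rewrite ge1r_powR// invr_gt0 ltr0n invf_le1 ?ler1n.
rewrite [X in X * _]muleC -muleA; apply: lee_wpmul2l; first exact: poweR_ge0.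
rewrite -EFinM lee_fin -invr_expz -invfM lef_pV2 ?posrE//; last first.
  by rewrite mulr_gt0// exprz_gt0.
by move: rj; rewrite /octave/= in_itv/= expfzDr// expr1z mulrC => /andP[_].
Qed.

Lemma sup_le_sup :
  ereal_sup [set G r | r in [set r : R | (0 < r)%R]]
    <= (c / (1 - q))%:E * ereal_sup [set b j | j in [set: int]].
Proof.
set S := ereal_sup [set b j | j in _].
have bS j : b j <= S by apply: ereal_sup_ubound; exists j.
have S0 : 0 <= S by exact: le_trans (bS 0%R).
apply: ge_ereal_sup => _ [r /= r0 <-]; have [j rj] := octave_cover r0.
apply: (le_trans (Gb rj)); apply: le_trans (geometric_nneseries_le c0 q01 S0).
apply: lee_nneseries => [i _ _|i _]; first by rewrite mule_ge0// lee_fin.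
by rewrite lee_wpmul2l// lee_fin.
Qed.

Lemma sup_ge_sup :
  (2 * c)^-1%:E * ereal_sup [set b j | j in [set: int]]
    <= ereal_sup [set G r | r in [set r : R | (0 < r)%R]].
Proof.
set S := leRHS.
have GS r : (0 < r)%R -> G r <= S by move=> r0; apply: ereal_sup_ubound; exists r.
have S0 : 0 <= S by apply: le_trans (GS 1%R _).
rewrite lee_pdivrMl ?mulr_gt0//; apply: ge_ereal_sup => _ [j _ <-].
have rj : octave j (2 ^ (j + 1) : R)%R.
  by rewrite /octave/= in_itv/= lexx andbT ltr_eXz2l ?ltr1n// ltzD1.
apply: (le_trans (bG rj)); apply: lee_pmul => //.
- by rewrite lee_fin ltW.
- by rewrite lee_fin ler_peMl ?ler1n ?ltW.
- by apply: GS; exact: octave_gt0 rj.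
Qed.

End Comparison.

Section Weights.
Variable R : realType.
Variable lambda : R.
Hypothesis l0 : 0 < lambda.

(** Rewrites the weight of the j-th octave in terms of that of the annulus of
    index j+1-i; the excess is the geometric factor 2^(-lambda i) that makes the
    sum over the annuli inside a ball converge. *)
Lemma weight_shift (j : int) (i : nat) :
  2 `^ (j%:~R * - lambda) =
  2 `^ lambda * (2 `^ (- lambda)) ^+ i * 2 `^ ((j + 1 - i%:Z)%:~R * - lambda) :> R.
Proof.
rewrite -powR_mulrn ?powR_ge0// -powRrM -!powRD; last 2 first.
- by rewrite pnatr_eq0 implybT.
- by rewrite pnatr_eq0 implybT.
congr (_ `^ _); rewrite rmorphB rmorphD/= -pmulrn; ring.
Qed.

Lemma weight_octave (j : int) (r : R) : octave j r ->
  r `^ (- lambda) <= 2 `^ (j%:~R * - lambda) <= 2 `^ lambda * r `^ (- lambda).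
Proof.
move=> rj; have r0 := octave_gt0 rj.
have anti (x y : R) : 0 < x -> x <= y -> y `^ (- lambda) <= x `^ (- lambda).
  move=> x0 xy; have y0 := lt_le_trans x0 xy.
  rewrite !powRN lef_pV2 ?posrE ?powR_gt0//.
  by apply: ge0_ler_powR => //; rewrite ?nnegrE; exact: ltW.
have wE k : (2 ^ k) `^ (- lambda) = 2 `^ (k%:~R * - lambda) :> R.
  by rewrite powRrM powR_intmul.
move: rj; rewrite /octave/= in_itv/= => /andP[jr rj].
apply/andP; split; first by rewrite -wE anti ?exprz_gt0// ltW.
rewrite (weight_shift j 0) expr0 mulr1 subr0 ler_wpM2l ?powR_ge0//.
by rewrite -wE anti.
Qed.

End Weights.

Theorem theorem8p1 (R : realType) (n : nat) (p : n.-tuple R)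
    (theta : \bar R) (lambda : R)
    (hp : forall i : 'I_n, 1 < tnth p i)
    (htheta : (1 <= theta)%E)
    (hlambda : 0 < lambda < \sum_(i < n) (tnth p i)^-1) :
  exists C : R, 1 <= C /\
    forall f : Rn R n -> R[i], lebesgue_measurable f ->
      ((C^-1)%:E * herz_norm p (- lambda) theta f
         <= local_morrey_norm p lambda theta f)%E /\
      (local_morrey_norm p lambda theta f
         <= C%:E * herz_norm p (- lambda) theta f)%E.
Proof.
case: n p hp hlambda => [|n] p hp /andP[l0 hl].
  (* for n = 0 the sum of the 1/p_i is empty and leaves no room for lambda *)
  by move: hl; rewrite big_ord0 ltNge ltW.
pose c : R := 2 `^ lambda; pose q : R := 2 `^ (- lambda).
have c1 : 1 <= c by rewrite -[1](powRr0 2) ler_powR ?ler1n// ltW.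
have c0 : 0 < c by exact: lt_le_trans c1.
have q0 : 0 < q by rewrite powR_gt0.
have q1 : q < 1.
  rewrite /q powRN invf_lt1 ?powR_gt0// -[ltLHS](congr1 (@^~ lambda) (@powR1 R)).
  by apply: gt0_ltr_powR; rewrite ?nnegrE ?ltr1n.
have q01 : 0 < q < 1 by rewrite q0.
have Dq : 0 < 1 - q by rewrite subr_gt0.
(* 2c / (1 - q) dominates the constants 2c and c / (1 - q) of the two bounds *)
exists (2 * c / (1 - q)); split.
  rewrite ler_pdivlMr// mul1r; apply: (@le_trans _ _ 1); last by lra.
  by rewrite gerBl ltW.
move=> f mf.
have [aM Ma] := local_norms (fun i => ltW (hp i)) mf.
pose a j := mixed_norm_on p (@dyadic_annulus R n.+1 j) f.
pose M r := mixed_norm_on p (@oball R n.+1 r) f.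
have norm0 E : (0 <= mixed_norm_on p E f)%E.
  by apply: iterated_Lnorm_ge0 => x; rewrite lee_fin normc_ge0.
pose b j : \bar R := ((2 `^ (j%:~R * - lambda))%:E * a j)%E.
pose G r : \bar R := ((r `^ (- lambda))%:E * M r)%E.
have b0 j : (0 <= b j)%E by rewrite mule_ge0 ?lee_fin ?powR_ge0//; exact: norm0.
have G0 r : (0 <= G r)%E by rewrite mule_ge0 ?lee_fin ?powR_ge0//; exact: norm0.
have bG j r : octave j r -> (b j <= c%:E * G r)%E.
  move=> rj; have /andP[_ wr] := weight_octave l0 rj.
  rewrite /G muleA -EFinM; apply: lee_pmul;
    [by rewrite lee_fin powR_ge0|exact: norm0|by rewrite lee_fin|].
  by apply: aM; move: rj; rewrite /octave/= in_itv/= => /andP[].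
have Gb j r : octave j r ->
    (G r <= \sum_(i <oo) ((c * q ^+ i)%:E * b (j + 1 - i%:Z)%R))%E.
  move=> rj; have /andP[wr _] := weight_octave l0 rj.
  apply: (@le_trans _ _ ((2 `^ (j%:~R * - lambda))%:E *
      \sum_(i <oo) a (j + 1 - i%:Z)%R)%E).
    apply: lee_pmul;
    [by rewrite lee_fin powR_ge0|exact: norm0|by rewrite lee_fin|].
    by apply: Ma; move: rj; rewrite /octave/= in_itv/= => /andP[].
  rewrite -nneseriesZl; last by move=> i _; exact: norm0.
  apply: lee_nneseries => [i _ _|i _].
    by rewrite mule_ge0 ?lee_fin ?powR_ge0//; exact: norm0.
  by rewrite /b muleA -EFinM -weight_shift.
suff [lo up] : ((2 * c)^-1%:E * herz_norm p (- lambda) theta f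
      <= local_morrey_norm p lambda theta f)%E /\
    (local_morrey_norm p lambda theta f
      <= (c / (1 - q))%:E * herz_norm p (- lambda) theta f)%E.
  have H0 : (0 <= herz_norm p (- lambda) theta f)%E.
    case: (theta) => [t||//] /=; first exact: poweR_ge0.
    apply: le_trans (b0 0) _; apply: ereal_sup_ubound; by exists 0.
  split; [apply: le_trans lo|apply: (le_trans up)]; apply: lee_wpmul2r => //;
    rewrite lee_fin.
    rewrite lef_pV2 ?posrE ?divr_gt0 ?mulr_gt0//.
    rewrite ler_pdivlMr// ler_piMr ?mulr_ge0 ?ltW//.
    by rewrite ltrBlDr ltrDl.
  by rewrite ler_wpM2r ?invr_ge0 ?ltW//; lra.
case: theta htheta => [t| |]; rewrite /= ?lee_fin => // t1; last first.
  by split; [exact: sup_ge_sup|exact: sup_le_sup].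
have -> : (\esum_(j in [set: int]) ((2 `^ (j%:~R * - lambda * t))%:E *
    mixed_norm_on p (@dyadic_annulus R n.+1 j) f `^ t))%E =
    (\esum_(j in [set: int]) b j `^ t)%E.
  apply: eq_esum => j _; rewrite /b poweRM; [|by rewrite lee_fin powR_ge0|exact: norm0].
  by rewrite powRrM.
by split; [exact: ell_le_integral|exact: integral_le_ell].
Qed.
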